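(* Let $\rho>0$ and let $\mathcal{K}\subset\mathbb{R}^d$ be a compact $\rho$-smooth convex body with $\operatorname{diam}(\mathcal{K})\le D$. Let $x\in\mathcal{K}$, $0<s\le D$, and $0\ne c\in\mathbb{R}^d$. Let $q=x-\tau\frac{c}{\|c\|}$, $0\le\tau\le s$, be the last point of the segment $[x,\,x-s\frac{c}{\|c\|}]$ (starting from $x$) that belongs to $\mathcal{K}$, and suppose $\tau<s$. Let $n$ be an outward supporting unit normal to $\mathcal{K}$ at $q$, let $$p\in\arg\min\{\langle c,z\rangle:\ z\in\mathbb{B}(x,s),\ \langle n,z-q\rangle\le 0\},$$ and let $\widehat p=\operatorname{proj}_{\mathbb{B}(q-\rho n,\rho)}(p)$. Then $\widehat p\in\mathcal{K}\cap\mathbb{B}(x,s)$ and $$\langle c,\widehat p\rangle\le\min_{z\in\mathcal{K}\cap\mathbb{B}(x,s)}\langle c,z\rangle+\frac{2}{\rho}\|c\|s^2.$$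
   Context: $\|\cdot\|$ and $\langle\cdot,\cdot\rangle$ are the Euclidean norm and inner product on $\mathbb{R}^d$; $\mathbb{B}(x,s)$ is the closed Euclidean ball of radius $s$ centered at $x$; $\operatorname{proj}_S$ is Euclidean projection onto a closed convex set $S$. A convex body is a compact convex set with nonempty interior. An outward supporting unit normal to $\mathcal{K}$ at $q\in\partial\mathcal{K}$ is a unit vector $n$ with $\langle n,z-q\rangle\le 0$ for all $z\in\mathcal{K}$. A convex body $\mathcal{K}$ is $\rho$-smooth if for every $q\in\partial\mathcal{K}$ and every outward supporting unit normal $n$ at $q$ one has $\mathbb{B}(q-\rho n,\rho)\subseteq\mathcal{K}$. *)

(* Defs.v *)
From mathcomp Require Import all_boot all_order all_algebra.
From mathcomp Require Import all_classical all_reals all_analysis.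

Set Implicit Arguments.
Unset Strict Implicit.
Unset Printing Implicit Defensive.

Import Order.TTheory GRing.Theory Num.Theory.
Import numFieldNormedType.Exports.

Local Open Scope classical_set_scope.
Local Open Scope ring_scope.

(* The library norm [`|u|] on ['rV[R]_d] is the sup norm; all metric notions
   below use the Euclidean norm [enorm] instead. Topological notions (compact,
   interior, closure) come from the library: both norms induce the same
   topology. *)

Definition dot (R : realType) (d : nat) (u v : 'rV[R]_d) : R :=
  \sum_(i < d) u ord0 i * v ord0 i.

Definition enorm (R : realType) (d : nat) (u : 'rV[R]_d) : R :=
  Num.sqrt (dot u u).

Definition eball (R : realType) (d : nat) (x : 'rV[R]_d) (s : R) :
    set 'rV[R]_d :=
  closed_ball_ (@enorm R d) x s.

Definition diam (R : realType) (d : nat) (K : set 'rV[R]_d) : \bar R :=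
  ereal_sup [set (enorm (x - y))%:E | x in K & y in K].

Definition boundary (T : topologicalType) (A : set T) : set T :=
  closure A `\` interior A.

Definition argmin (R : realType) (T : Type) (S : set T) (f : T -> R) : set T :=
  [set z | S z /\ forall w, S w -> f z <= f w].

(* For [S] nonempty, closed and convex the minimizer exists and is unique; the
   default value [p] of [xget] is only used when there is no minimizer. *)
Definition eproj (R : realType) (d : nat) (S : set 'rV[R]_d) (p : 'rV[R]_d) :
    'rV[R]_d :=
  xget p (argmin S (fun z => enorm (p - z))).

Definition convex_body (R : realType) (d : nat) (K : set 'rV[R]_d) : Prop :=
  [/\ compact K, convex_set K & interior K !=set0].

Definition outward_unit_normal (R : realType) (d : nat)
    (K : set 'rV[R]_d) (q n : 'rV[R]_d) : Prop :=
  enorm n = 1 /\ forall z, K z -> dot n (z - q) <= 0.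

Definition rho_smooth (R : realType) (d : nat) (rho : R)
    (K : set 'rV[R]_d) : Prop :=
  forall q, boundary K q -> forall n, outward_unit_normal K q n ->
    eball (q - rho *: n) rho `<=` K.

(* Main.v *)
(* Everything rests on the point [p] itself, not on its explicit form. Write
   [o = q - rho n] and [e = c / |c|]; smoothness puts [phat] in [K]. Since [q] is
   feasible for the problem defining [p], [<e, p - q> <= 0], and [x - q = tau e]
   with [tau <n, e> <= 0]; together with [|phat - q| <= |p - q|] this makes
   [phat] at most as far from [x] as [p] is. Moreover [<n, p - q> <= 0] gives
   [|p - o|^2 <= |p - q|^2 + rho^2], so
   [|p - phat| <= |p - q|^2 / (2 rho) <= 2 s^2 / rho], while [<c, p>] is at most
   the minimum over [K `&` eball x s] because [K] lies in the half-space. *)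
Require Import Defs.
From mathcomp Require Import all_boot all_order all_algebra.
From mathcomp Require Import all_classical all_reals all_analysis.
From mathcomp Require Import ring lra.

Set Implicit Arguments.
Unset Strict Implicit.
Unset Printing Implicit Defensive.

Import Order.TTheory GRing.Theory Num.Theory.
Import numFieldNormedType.Exports.

Local Open Scope classical_set_scope.
Local Open Scope ring_scope.

Section Euclidean.
Variables (R : realType) (d : nat).
Implicit Types (u v w x p q o : 'rV[R]_d) (a s rho : R).

(** * Algebra of the Euclidean inner product and norm *)

Lemma dotC u v : dot u v = dot v u.
Proof. by apply: eq_bigr => i _; rewrite mulrC. Qed.

Lemma dotDl u v w : dot (u + v) w = dot u w + dot v w.
Proof. by rewrite -big_split; apply: eq_bigr => i _; rewrite mxE mulrDl. Qed.

Lemma dotZl a u w : dot (a *: u) w = a * dot u w.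
Proof. by rewrite mulr_sumr; apply: eq_bigr => i _; rewrite mxE mulrA. Qed.

Lemma dotNl u w : dot (- u) w = - dot u w.
Proof. by rewrite -scaleN1r dotZl mulN1r. Qed.

Lemma dotDr w u v : dot w (u + v) = dot w u + dot w v.
Proof. by rewrite !(dotC w) dotDl. Qed.

Lemma dotZr a w u : dot w (a *: u) = a * dot w u.
Proof. by rewrite !(dotC w) dotZl. Qed.

Lemma dotNr w u : dot w (- u) = - dot w u.
Proof. by rewrite !(dotC w) dotNl. Qed.

Definition dotE := (dotDl, dotDr, dotNl, dotNr, dotZl, dotZr).

Lemma dot_ge0 u : 0 <= dot u u.
Proof. by apply: sumr_ge0 => i _; rewrite -expr2 sqr_ge0. Qed.

Lemma dot_eq0 u : dot u u = 0 -> u = 0.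
Proof.
move/eqP; rewrite psumr_eq0 => [/allP u0|i _]; last by rewrite -expr2 sqr_ge0.
apply/rowP => i; rewrite mxE; apply/eqP.
by have := u0 i (mem_index_enum i); rewrite mulf_eq0 orbb.
Qed.

Lemma enorm_ge0 u : 0 <= enorm u.
Proof. exact: sqrtr_ge0. Qed.

Lemma sqr_enorm u : enorm u ^+ 2 = dot u u.
Proof. by rewrite sqr_sqrtr ?dot_ge0. Qed.

Lemma enorm_le a u : 0 <= a -> (enorm u <= a) = (dot u u <= a ^+ 2).
Proof. by move=> a0; rewrite -sqr_enorm ler_sqr ?nnegrE ?enorm_ge0. Qed.

Lemma enormZ a u : 0 <= a -> enorm (a *: u) = a * enorm u.
Proof.
move=> a0; rewrite /enorm !dotE mulrA -expr2 sqrtrM ?sqr_ge0//.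
by rewrite sqrtr_sqr ger0_norm.
Qed.

Lemma enormN u : enorm (- u) = enorm u.
Proof. by rewrite /enorm !dotE opprK. Qed.

Lemma enorm0_eq u : enorm u = 0 -> u = 0.
Proof. by move=> u0; apply: dot_eq0; rewrite -sqr_enorm u0 expr0n. Qed.

Lemma enorm0 : enorm (0 : 'rV[R]_d) = 0.
Proof. by rewrite /enorm -(scale0r 0) dotZl mul0r sqrtr0. Qed.

(** Cauchy-Schwarz, by expanding the squared norm of [enorm v *: u - enorm u *: v] and cancelling
    the factor [enorm u * enorm v]; zero vectors are treated first so that this factor is
    positive. *)
Lemma dot_le_enorm u v : dot u v <= enorm u * enorm v.
Proof.
have [/enorm0_eq ->|u0] := eqVneq (enorm u) 0.
  by rewrite -(scale0r 0) dotZl mul0r mulr_ge0 ?enorm_ge0.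
have [/enorm0_eq ->|v0] := eqVneq (enorm v) 0.
  by rewrite -(scale0r 0) dotZr mul0r mulr_ge0 ?enorm_ge0.
have uv0 : 0 < enorm u * enorm v by rewrite mulr_gt0 ?lt0r ?u0 ?v0 ?enorm_ge0.
have := dot_ge0 (enorm v *: u - enorm u *: v).
rewrite !dotE (dotC v u) -!sqr_enorm => h.
rewrite -(ler_pM2l uv0); nra.
Qed.

Lemma enormD u v : enorm (u + v) <= enorm u + enorm v.
Proof.
rewrite enorm_le ?addr_ge0 ?enorm_ge0// !dotE (dotC v u) -!sqr_enorm.
by have := dot_le_enorm u v; nra.
Qed.

(** * Continuity and closedness in Euclidean terms *)

Lemma dot_continuous u : continuous (dot u).
Proof.
apply: (@continuous_big _ _ +%R 0 xpredT add_continuous _ _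
  (fun i v => u ord0 i * v ord0 i)) => i _ v.
by apply: continuousM; [exact: cst_continuous | exact: coord_continuous].
Qed.

Lemma enorm_continuous : continuous (@enorm R d).
Proof.
move=> v; apply: continuous_comp; last exact: sqrt_continuous.
apply: (@continuous_big _ _ +%R 0 xpredT add_continuous _ _
  (fun i u => u ord0 i * u ord0 i)) => i _ u.
by apply: continuousM; exact: coord_continuous.
Qed.

Lemma eballE x s y : eball x s y = (enorm (y - x) <= s).
Proof. by rewrite /eball /closed_ball_ /= -opprB enormN. Qed.

Lemma eball_closed x s : closed (eball x s).
Proof.
apply: (preimage_closed _ (@closed_le _ _)) => y _.
apply: continuous_comp; last exact: enorm_continuous.
by apply: continuousB; [exact: cst_continuous | exact: cvg_id].
Qed.

(** * Projection onto a Euclidean ball *)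

Lemma eproj_id (S : set 'rV[R]_d) p : S p -> eproj S p = p.
Proof.
move=> Sp; apply: xget_unique => [|y [_ /(_ p Sp)]].
  by split=> // w _; rewrite subrr enorm0 enorm_ge0.
rewrite subrr enorm0 => py; apply/esym/eqP; rewrite -subr_eq0; apply/eqP.
by apply: enorm0_eq; apply/eqP; rewrite eq_le py enorm_ge0.
Qed.

(** The radial point is at distance [r - rho] from [p], which the triangle inequality through any
    [w] of the ball shows to be minimal. Since [eproj] picks some minimizer, uniqueness has to be
    proved as well. *)
Lemma eproj_eball o p rho : 0 < rho -> rho < enorm (p - o) ->
  eproj (eball o rho) p = o + (rho / enorm (p - o)) *: (p - o).
Proof.
move=> rho0 rp; set r := enorm (p - o) in rp *; set u := p - o.
have r0 : 0 < r by lra.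
have uu : dot u u = r ^+ 2 by rewrite sqr_enorm.
set l := rho / r; have lr : l * r = rho by rewrite /l; field; rewrite gt_eqF.
have l0 : 0 <= l by rewrite divr_ge0 ?ltW.
have l1 : l < 1 by rewrite /l ltr_pdivrMr ?mul1r.
clearbody l.
have pyE : p - (o + l *: u) = (1 - l) *: u.
  by rewrite scalerBl scale1r /u opprD addrA.
apply: xget_unique => [|y [oy]].
  split=> [|w]; rewrite eballE.
    by rewrite addrC addKr enormZ// lr.
  move=> ow.
  have -> : enorm (p - (o + l *: u)) = r - rho.
    by rewrite pyE enormZ ?subr_ge0 ?ltW// mulrBl mul1r lr.
  have := enormD (p - w) (w - o); rewrite addrA subrK -/r; lra.
rewrite eballE in oy.
move=> /(_ (o + l *: u)); rewrite /= eballE pyE (addrC o).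
rewrite addrK !enormZ ?subr_ge0 ?(ltW l1)// lr mulrBl mul1r lr -/r => /(_ (lexx _)) h.
move: oy h; rewrite !enorm_le ?subr_ge0 ?(ltW rho0) ?(ltW rp)//.
have -> : p - y = u - (y - o) by rewrite /u opprB addrA subrK.
set w := y - o => ww uw.
(* Stewart's identity [|w - l u|^2 = (1 - l)|w|^2 + l|u - w|^2 - l(1 - l)r^2]: the bounds
   [|w| <= l r] and [|u - w| <= (1 - l) r] make the right side at most 0. *)
suff /eqP : w - l *: u = 0 by rewrite subr_eq0 => /eqP <-; rewrite subrK.
apply: dot_eq0; apply/eqP; rewrite eq_le dot_ge0 andbT; clearbody w u.
by move: ww uw; rewrite !dotE (dotC w u) uu -lr; nra.
Qed.

Lemma eproj_eball_nonexpansive o p q rho : 0 < rho -> eball o rho q ->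
  enorm (eproj (eball o rho) p - q) <= enorm (p - q).
Proof.
rewrite eballE => rho0 oq.
have [po|po] := leP (enorm (p - o)) rho.
  by rewrite eproj_id ?eballE.
rewrite eproj_eball//; set r := enorm (p - o) in po *; set u := p - o.
have uu : dot u u = r ^+ 2 by rewrite sqr_enorm.
have r0 : 0 < r by lra.
set l := rho / r; have lr : l * r = rho by rewrite /l; field; rewrite gt_eqF.
have l0 : 0 <= l by rewrite divr_ge0 ?ltW.
have l1 : l < 1 by rewrite /l ltr_pdivrMr ?mul1r.
clearbody l.
have -> : o + l *: u - q = l *: u - (q - o) by rewrite opprB addrCA addrA.
have -> : p - q = u - (q - o) by rewrite /u opprB addrA subrK.
set v := q - o in oq *.
have uv : dot u v <= r * rho.
  by apply: (le_trans (dot_le_enorm _ _)); rewrite ler_pM2l.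
clearbody u v; rewrite enorm_le ?enorm_ge0// sqr_enorm !dotE (dotC v u) uu.
(* This is [|l u - v|^2 <= |u - v|^2] rearranged. Once [dot u v] is replaced by its bound [r * rho],
   the slack is exactly [(r - rho)^2]. *)
suff : (1 - l) * (dot u v * 2) <= r ^+ 2 - rho ^+ 2.
  by rewrite -lr; nra.
apply: (@le_trans _ _ ((1 - l) * (r * rho * 2))).
  by rewrite ler_wpM2l ?ler_wpM2r//; lra.
by have := sqr_ge0 (r - rho); rewrite -lr; nra.
Qed.

(** * Boundary points on a ray, and attained minima *)

Lemma boundary_last_point (K : set 'rV[R]_d) x u s tau :
    tau < s -> K (x - tau *: u) ->
    (forall t, tau < t -> t < s -> ~ K (x - t *: u)) ->
  boundary K (x - tau *: u).
Proof.
move=> taus Kq Kout; split; first exact: subset_closure.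
move=> Kint.
have cont : (x - t *: u) @[t --> tau^'+] --> x - tau *: u.
  apply: cvg_at_right_filter; apply: cvgB; first exact: cvg_cst.
  by apply: cvgZl; exact: cvg_id.
(* If the point were interior, parameters slightly above [tau] would still give points of [K]; the
   right neighbourhoods of [tau] form a proper filter, so such a parameter exists. *)
have : \forall t \near tau^'+, False.
  near=> t; apply: (Kout t); near: t.
  - exact: nbhs_right_gt.
  - exact: nbhs_right_lt.
  - exact: (cont K Kint).
by case/filter_ex.
Unshelve. all: by end_near. Qed.

Lemma argmin_compact (K : set 'rV[R]_d) u :
  K !=set0 -> compact K -> argmin K (dot u) !=set0.
Proof.
move=> K0 cK.
have [|z zK zmin] := @EVT_min_rV R d (dot u) K K0 cK.
  by apply: continuous_subspaceT; exact: dot_continuous.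
exists z; split; first by rewrite inE in zK.
by move=> w Kw; apply: zmin; rewrite inE.
Qed.

End Euclidean.

Theorem lemma2p3 (R : realType) (d : nat) (rho D s tau : R)
    (K : set 'rV[R]_d) (x c q n p phat : 'rV[R]_d)
    (rho_gt0 : 0 < rho)
    (K_body : convex_body K)
    (K_smooth : rho_smooth rho K)
    (K_diam : (diam K <= D%:E)%E)
    (Kx : K x)
    (s_gt0 : 0 < s) (s_le_D : s <= D)
    (c_neq0 : c != 0)
    (q_def : q = x - tau *: ((enorm c)^-1 *: c))
    (tau_ge0 : 0 <= tau) (tau_le_s : tau <= s)
    (Kq : K q)
    (q_last : forall t : R, 0 <= t -> t <= s ->
       K (x - t *: ((enorm c)^-1 *: c)) -> t <= tau)
    (tau_lt_s : tau < s)
    (n_normal : outward_unit_normal K q n)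
    (p_argmin : argmin (eball x s `&` [set z | dot n (z - q) <= 0]) (dot c) p)
    (phat_def : phat = eproj (eball (q - rho *: n) rho) p) :
  (K `&` eball x s) phat /\
  exists2 z, argmin (K `&` eball x s) (dot c) z &
    dot c phat <= dot c z + 2 / rho * enorm c * s ^+ 2.
Proof.
set e := (enorm c)^-1 *: c in q_def q_last.
have C0 : 0 < enorm c.
  by rewrite lt0r enorm_ge0 andbT; apply: contra_neq c_neq0 => /enorm0_eq.
have ce : c = enorm c *: e by rewrite scalerA divff ?scale1r// gt_eqF.
have ee : dot e e = 1.
  by rewrite -sqr_enorm enormZ ?invr_ge0 ?enorm_ge0// mulVf ?gt_eqF// expr1n.
clearbody e.
have nn : dot n n = 1 by rewrite -sqr_enorm n_normal.1 expr1n.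
have xq : x - q = tau *: e by rewrite q_def opprB addrC subrK.
(* Here [tau < s] leaves room beyond [q] on the segment, and smoothness becomes available at [q]. *)
have qB : boundary K q.
  rewrite q_def; apply: (boundary_last_point tau_lt_s); first by rewrite -q_def.
  move=> t taut ts /(q_last t (ltW (le_lt_trans tau_ge0 taut)) (ltW ts)).
  by rewrite leNgt taut.
have ballK := K_smooth q qB n n_normal.
(* The factor [tau] stays: when [tau = 0], testing the normal against [x] says nothing about the
   sign of [dot n e]. *)
have ne : tau * dot n e <= 0.
  by have := n_normal.2 x Kx; rewrite xq dotZr.
have [[xp np] pmin] := p_argmin.
have qx : eball x s q.
  rewrite eballE -opprB enormN xq enorm_le ?(ltW s_gt0)// dotZl dotZr ee.
  by rewrite mulr1 -expr2 ler_sqr ?nnegrE// ltW.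
have {}np : dot n (p - q) <= 0 by [].
have pq : dot e (p - q) <= 0.
  have : dot c p <= dot c q.
    by apply: pmin; split=> //=; rewrite subrr -(scale0r 0) dotZr mul0r.
  by rewrite ce !dotZl ler_pM2l// dotDr dotNr subr_le0.
have xp' : dot (x - p) (x - p) <= s ^+ 2 by rewrite -enorm_le ?(ltW s_gt0).
set o := q - rho *: n in ballK phat_def.
have oq : eball o rho q.
  rewrite eballE opprB addrC subrK enorm_le ?(ltW rho_gt0)//.
  by rewrite dotZl dotZr nn mulr1 -expr2.
have hq := eproj_eball_nonexpansive p rho_gt0 oq; rewrite -phat_def in hq.
(* The set is compact and contains [q], so the minimum in the conclusion is attained. *)
have [z zmin] : argmin (K `&` eball x s) (dot c) !=set0.
  apply: argmin_compact; first by exists q.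
  apply: compact_closedI; [by case: K_body | exact: eball_closed].
have pz : dot c p <= dot c z.
  by apply: pmin; case: zmin => -[Kz xz] _; split=> //; exact: n_normal.2.
(* Cauchy-Schwarz for [c] and [phat - p] turns the excess cost into a distance. *)
suff [phatK phatx phatp] : [/\ K phat, eball x s phat &
    enorm (phat - p) <= 2 / rho * s ^+ 2].
  split=> //; exists z => //.
  have := dot_le_enorm c (phat - p); rewrite dotDr dotNr => h.
  have : enorm c * enorm (phat - p) <= enorm c * (2 / rho * s ^+ 2).
    by rewrite ler_pM2l.
  by lra.
have [po|po] := leP (enorm (p - o)) rho.
  have op : eball o rho p by rewrite eballE.
  rewrite phat_def eproj_id//; split=> //; first exact: ballK.
  by rewrite subrr enorm0 mulr_ge0 ?sqr_ge0// divr_ge0// ltW.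
have pE : phat = _ := etrans phat_def (eproj_eball rho_gt0 po).
set r := enorm (p - o) in po pE; set u := p - o in pE.
have uu : dot u u = r ^+ 2 by rewrite sqr_enorm.
have r0 : 0 < r by lra.
set l := rho / r in pE.
have lr : l * r = rho by rewrite /l; field; rewrite gt_eqF.
have l0 : 0 <= l by rewrite divr_ge0 ?ltW.
have l1 : l < 1 by rewrite /l ltr_pdivrMr ?mul1r.
clearbody l.
have uE : u = p - q + rho *: n by rewrite /u /o opprB addrA addrAC.
set w := p - q in np pq hq uE.
have r_le : r ^+ 2 <= dot w w + rho ^+ 2.
  by rewrite -uu uE; clearbody w; rewrite !dotE nn (dotC w n); nra.
(* Both [p] and [q] lie within [s] of [x]. *)
have w_le : dot w w <= (2 * s) ^+ 2.
  rewrite -enorm_le; last by lra.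
  have := enormD (p - x) (x - q); rewrite addrA subrK -/w => h.
  by move: xp qx; rewrite !eballE -(opprB x q) enormN; lra.
split.
- apply: ballK; rewrite eballE pE addrC addKr.
  by rewrite enormZ// lr.
- have phq : phat - q = l *: w - ((1 - l) * rho) *: n.
    rewrite pE uE /o; apply/rowP => i; rewrite !mxE; ring.
  have xphat : x - phat = tau *: e - (phat - q) by rewrite -xq opprB addrA subrK.
  have xpE : x - p = tau *: e - w by rewrite -xq opprB addrA subrK.
  have hq2 : dot (phat - q) (phat - q) <= dot w w.
    by rewrite -!sqr_enorm ler_sqr ?nnegrE ?enorm_ge0.
  (* The right side minus the left is [-(1 - l)(tau <e, w> + rho tau <n, e>)], and both terms in the
     bracket are nonpositive. *)
  have ephq : tau * dot e w <= tau * dot e (phat - q).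
    clearbody w; rewrite phq !dotE (dotC e n).
    have ew : tau * dot e w <= 0 by rewrite mulr_ge0_le0.
    have rne : rho * (tau * dot n e) <= 0 by rewrite mulr_ge0_le0// ltW.
    have : (1 - l) * (tau * dot e w + rho * (tau * dot n e)) <= 0.
      by rewrite mulr_ge0_le0//; lra.
    by lra.
  (* Expanding around [q], [|x - y|^2 = tau^2 - 2 tau <e, y - q> + |y - q|^2]; going from [y = p] to
     [y = phat] increases neither of the last two terms. *)
  rewrite eballE -opprB enormN enorm_le ?(ltW s_gt0)// xphat.
  move: xp'; rewrite xpE; set y := phat - q in hq2 ephq *; clearbody w y.
  by rewrite !dotE ee (dotC w e) (dotC y e); lra.
- have php : phat - p = (l - 1) *: u.
    by rewrite pE /u; apply/rowP => i; rewrite !mxE; ring.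
  apply: (@le_trans _ _ (r - rho)).
    by rewrite -enormN php -scaleNr opprB enormZ ?subr_ge0 ?(ltW l1)// mulrBl mul1r lr.
  (* The constant 2 comes from [2 rho (r - rho) <= r^2 - rho^2 <= |w|^2 <= 4 s^2]. *)
  rewrite mulrAC ler_pdivlMr//.
  nra.
Qed.
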